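(* Let $\tilde\phi(t)$, $0\le t\le T$, be a smooth planar curve without inflection points, and let $\phi(t)=a(t)(\tilde\phi(t),1)\in\mathbb{R}^3$ be a representative with $[\phi(t),\phi'(t),\phi''(t)]=1$ for all $t$. For each sufficiently large $N$ let $h=T/N$ and let $\phi(i)=\phi(t)|_{t=ih}$, $\tilde\phi(i)=\tilde\phi(t)|_{t=ih}$, $i=1,\dots,N$, be the polygons obtained by uniform sampling; assume that $\phi(i)$ is equal-volume with respect to the origin, i.e. $[\phi(i-1),\phi(i),\phi(i+1)]$ does not depend on $i$, so that its discrete invariants $\rho_1,\rho_2,\tau(i+\tfrac12)$ are defined. Then the discrete projective lengths $pl_1$ and $pl_2$ of the sampled polygon $\tilde\phi(i)$ both converge to the smooth projective length $pl(\tilde\phi)$ of the curve $\tilde\phi(t)$ when $h\to0$.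
   Context: $[\cdot,\cdot,\cdot]$ is the determinant in $\mathbb{R}^3$. For functions of the continuous variable $t$ primes are derivatives; for functions of the discrete index primes are differences: $f'(i+\tfrac12)=f(i+1)-f(i)$, $f''(i)=f'(i+\tfrac12)-f'(i-\tfrac12)$, $f'''(i+\tfrac12)=f''(i+1)-f''(i)$. Cube roots are real cube roots. Smooth projective length: since $[\phi,\phi',\phi'']=1$, there are functions $\rho(t),\tau(t)$ with $\phi'''(t)=-\rho(t)\phi'(t)+\tau(t)\phi(t)$, and $$pl(\tilde\phi)=\int_0^T\left(\rho'(t)+2\tau(t)\right)^{1/3}dt.$$ Discrete projective lengths: for a polygon $\phi(i)$ in $\mathbb{R}^3$ with $[\phi(i-1),\phi(i),\phi(i+1)]$ equal to a nonzero constant independent of $i$, the vector $\phi'''(i+\tfrac12)$ lies in the plane generated by $\phi(i)$ and $\phi(i+1)$, and $\rho_1,\rho_2,\tau(i+\tfrac12)$ are defined, for $2\le i\le N-2$, by $$\phi'''(i+\tfrac12)=-\rho_2(i)\phi'(i+\tfrac12)+\tau(i+\tfrac12)\phi(i+1),\qquad \phi'''(i+\tfrac12)=-\rho_1(i+1)\phi'(i+\tfrac12)+\tau(i+\tfrac12)\phi(i).$$ Then, with $\rho_k'(i+\tfrac12)=\rho_k(i+1)-\rho_k(i)$, $$pl_1(\tilde\phi)=\sum_i\left(\rho_1'(i+\tfrac12)+2\tau(i+\tfrac12)\right)^{1/3},\qquad pl_2(\tilde\phi)=\sum_i\left(\rho_2'(i+\tfrac12)+2\tau(i+\tfrac12)\right)^{1/3},$$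 where each sum is over all $i$ with $2\le i\le N-2$ for which the summand is defined (that is, $3\le i\le N-2$ for $pl_1$ and $2\le i\le N-3$ for $pl_2$). *)

(* Defs.v *)
From HB Require Import structures.
From mathcomp Require Import all_boot all_order all_algebra.
From mathcomp Require Import all_classical all_reals all_analysis.
Set Implicit Arguments.
Unset Strict Implicit.
Unset Printing Implicit Defensive.
Import Order.TTheory GRing.Theory Num.Theory.
Import numFieldNormedType.Exports.
Local Open Scope classical_set_scope.
Local Open Scope ring_scope.

Section SmoothOnSet.
Context (R : realType) (V : normedModType R).
Implicit Types (I : set R) (f : R -> V) (t : R).

(* Derivatives relative to a set I: the limits are taken through points of I
   only, so that on I = `[0, T] they are one-sided at the endpoints and the
   values of f outside I play no role. *)
Definition difference_quotient f t (s : R) : V := (s - t)^-1 *: (f s - f t).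

Definition derivable_on I f t : Prop :=
  cvg (difference_quotient f t @ within I t^').

Definition derive_on I f t : V :=
  lim (difference_quotient f t @ within I t^').

Definition derive_onn I n f : R -> V := iter n (derive_on I) f.

Definition smooth_on I f : Prop :=
  forall n t, I t -> derivable_on I (derive_onn I n f) t.

End SmoothOnSet.

Section ProjectiveLength.
Context (R : realType).

Definition cbrt (x : R) : R := Num.sg x * (`|x| `^ 3^-1).

Definition bracket2 (u v : 'rV[R]_2) : R := \det (col_mx u v : 'M[R]_2).

Definition bracket3 (u v w : 'rV[R]_3) : R :=
  \det (col_mx u (col_mx v w) : 'M[R]_3).

Definition lift_curve (a : R -> R) (c : R -> 'rV[R]_2) (t : R) : 'rV[R]_3 :=
  a t *: (row_mx (c t) (1 : 'rV[R]_1) : 'rV[R]_3).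

Definition without_inflection (I : set R) (c : R -> 'rV[R]_2) : Prop :=
  forall t, I t -> bracket2 (derive_onn I 1 c t) (derive_onn I 2 c t) != 0.

Section Smooth.
Context (T : R) (phi : R -> 'rV[R]_3).
Local Notation I := (`[0, T]%classic : set R).

(* The pair (rho, tau) at t; it exists and is unique when
   [phi, phi', phi''] = 1 on I. *)
Definition smooth_invariants (t : R) : R * R :=
  get [set p : R * R | derive_onn I 3 phi t =
         - p.1 *: derive_onn I 1 phi t + p.2 *: phi t].

Definition smooth_rho (t : R) : R := (smooth_invariants t).1.
Definition smooth_tau (t : R) : R := (smooth_invariants t).2.

Definition pl : R :=
  \int[lebesgue_measure]_(t in I)
    cbrt (derive_on I (smooth_rho : R -> R^o) t + 2 * smooth_tau t).

End Smooth.

(* Half-integer indices are rounded down: the value at i of [diff1 f], [diff3 f]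
   and [disc_tau] is the quantity attached to the index i + 1/2. *)
Definition diff1 (V : zmodType) (f : nat -> V) (i : nat) : V := f i.+1 - f i.
Definition diff2 (V : zmodType) (f : nat -> V) (i : nat) : V :=
  diff1 f i - diff1 f i.-1.
Definition diff3 (V : zmodType) (f : nat -> V) (i : nat) : V :=
  diff2 f i.+1 - diff2 f i.

Section Discrete.
(* The vertices are p 1, ..., p N; the other values of p are irrelevant. *)
Context (N : nat) (p : nat -> 'rV[R]_3).

Definition equal_volume : Prop :=
  exists v : R, forall i, (1 < i < N)%N ->
    bracket3 (p i.-1) (p i) (p i.+1) = v.

(* The triple (rho_1(i+1), rho_2(i), tau(i+1/2)); for 2 <= i <= N - 2 it exists
   and is unique when p is equal-volume with nonzero constant. *)
Definition disc_invariants (i : nat) : R * R * R :=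
  get [set x : R * R * R |
    diff3 p i = - x.1.2 *: diff1 p i + x.2 *: p i.+1 /\
    diff3 p i = - x.1.1 *: diff1 p i + x.2 *: p i].

Definition disc_rho1 (i : nat) : R := (disc_invariants i.-1).1.1.
Definition disc_rho2 (i : nat) : R := (disc_invariants i).1.2.
Definition disc_tau (i : nat) : R := (disc_invariants i).2.

Definition pl1 : R :=
  \sum_(3 <= i < N.-1) cbrt (diff1 disc_rho1 i + 2 * disc_tau i).
Definition pl2 : R :=
  \sum_(2 <= i < N.-2) cbrt (diff1 disc_rho2 i + 2 * disc_tau i).

End Discrete.

Definition sample (V : Type) (T : R) (f : R -> V) (N i : nat) : V :=
  f (i%:R * (T / N%:R)).

End ProjectiveLength.

(* Main.v *)
Require Import Defs.
From HB Require Import structures.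
From mathcomp Require Import all_boot all_order all_algebra.
From mathcomp Require Import all_classical all_reals all_analysis.
From mathcomp Require Import ring lra zify.
Import Order.TTheory GRing.Theory Num.Theory.
Import numFieldNormedType.Exports.
Local Open Scope classical_set_scope.
Local Open Scope ring_scope.
Set Implicit Arguments.
Unset Strict Implicit.
Unset Printing Implicit Defensive.

(** Fix a parameter t and read vectors in the frame phi, phi', phi'' of
    determinant 1 at t: alpha v = [v, phi', phi''] and beta v = [phi, v, phi'']
    are the coordinates of v along phi and phi'. Equal volumes mean that four
    consecutive vertices satisfy a recurrence

      p(i+2) - p(i-1) = A p(i+1) + B p(i),

    and the discrete invariants are rho_1(i+1) = 3 - A, rho_2(i) = B + 3 and
    tau(i+1/2) = A + B. Apply beta and alpha to the recurrence at t = ih and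
    Taylor expand the scalar functions s |-> beta (phi s) and
    s |-> alpha (phi s) about t. This gives, uniformly in t
    ([local_expansion]),

      A = 3 - h^2 rho + (h^3 / 2) b + O(h^4),    A + B = h^3 tau + O(h^4),

    where b = [phi, phi'''', phi''].

    A summand of either discrete length involves two successive recurrences. If
    both are expanded about the vertex that they share, the second is the first
    with h changed into - h, and the two kinds of summands both become
    h^3 (3 tau - b) + O(h^4) ([summand_expansion]). On the other hand,
    differentiating rho = [phi, phi'', phi'''] gives rho' = tau - b
    ([is_derive_on_frame_rho]), so 3 tau - b is the smooth density
    rho' + 2 tau.

    The cube root is Hoelder of exponent 1/3, so the summands are
    h (rho' + 2 tau)^(1/3) + o(h) uniformly ([sum_cbrt_cvg]), and their sums
    converge to the integral like Riemann sums ([riemann_sum_cvg]). *)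

(** * The determinant of three vectors *)

Section Bracket.
Context (R : realType).
Implicit Types u v w x : 'rV[R]_3.

Local Notation o i := (inord i : 'I_3).

Lemma bracket3E u v w : bracket3 u v w =
  u 0 (o 0) * (v 0 (o 1) * w 0 (o 2) - v 0 (o 2) * w 0 (o 1))
  - u 0 (o 1) * (v 0 (o 0) * w 0 (o 2) - v 0 (o 2) * w 0 (o 0))
  + u 0 (o 2) * (v 0 (o 0) * w 0 (o 1) - v 0 (o 1) * w 0 (o 0)).
Proof.
have det2 (A : 'M[R]_2) : \det A = A (inord 0) (inord 0) * A (inord 1) (inord 1)
    - A (inord 0) (inord 1) * A (inord 1) (inord 0).
  pose a i j := A (inord i) (inord j).
  have Am i j : A i j = a i j by rewrite /a !inord_val.
  rewrite (expand_det_row _ ord0) !big_ord_recl big_ord0 /cofactor !det_mx11.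
  by rewrite !mxE /= !Am /= !inordK//=; ring.
have det3 (A : 'M[R]_3) : \det A =
    A (o 0) (o 0) * (A (o 1) (o 1) * A (o 2) (o 2) - A (o 1) (o 2) * A (o 2) (o 1))
    - A (o 0) (o 1) * (A (o 1) (o 0) * A (o 2) (o 2) - A (o 1) (o 2) * A (o 2) (o 0))
    + A (o 0) (o 2) * (A (o 1) (o 0) * A (o 2) (o 1) - A (o 1) (o 1) * A (o 2) (o 0)).
  pose a i j := A (inord i) (inord j).
  have Am i j : A i j = a i j by rewrite /a !inord_val.
  rewrite (expand_det_row _ ord0) !big_ord_recl big_ord0 /cofactor !det2.
  by rewrite !mxE /= !Am /= !inordK//=; ring.
rewrite /bracket3 det3.
have E0 (p : 'I_3) : p = 0%N :> nat -> p = lshift 2 (ord0 : 'I_1).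
  by move=> ?; exact/val_inj.
have E1 (p : 'I_3) : p = 1%N :> nat -> p = rshift 1 (lshift 1 (ord0 : 'I_1)).
  by move=> ?; exact/val_inj.
have E2 (p : 'I_3) : p = 2%N :> nat -> p = rshift 1 (rshift 1 (ord0 : 'I_1)).
  by move=> ?; exact/val_inj.
have M0 j : (col_mx u (col_mx v w) : 'M[R]_3) (o 0) j = u 0 j.
  by rewrite (E0 (o 0)) ?inordK//; exact: col_mxEu.
have M1 j : (col_mx u (col_mx v w) : 'M[R]_3) (o 1) j = v 0 j.
  rewrite (E1 (o 1)) ?inordK//.
  by apply: etrans (col_mxEd _ _ _ _) _; exact: col_mxEu.
have M2 j : (col_mx u (col_mx v w) : 'M[R]_3) (o 2) j = w 0 j.
  rewrite (E2 (o 2)) ?inordK//.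
  by apply: etrans (col_mxEd _ _ _ _) _; exact: col_mxEd.
by rewrite !M0 !M1 !M2.
Qed.

(** Cramer's rule: the brackets of a frame with one vector replaced by [x] are
    the coordinates of [x], which turns vector equations into scalar ones. *)
Lemma bracket3_cramer u v w x : bracket3 u v w *: x =
  bracket3 x v w *: u + bracket3 u x w *: v + bracket3 u v x *: w.
Proof.
apply/rowP => j; rewrite !mxE !bracket3E.
have: [|| j == o 0, j == o 1 | j == o 2].
  by rewrite -!(inj_eq val_inj) /= !inordK//; case: j => -[|[|[|]]].
by case/or3P => /eqP ->; ring.
Qed.

Lemma cvg_bracket3 (T : Type) (F : set_system T) (FF : Filter F)
    (f g h : T -> 'rV[R]_3) u v w :
  f @ F --> u -> g @ F --> v -> h @ F --> w ->
  bracket3 (f x) (g x) (h x) @[x --> F] --> bracket3 u v w.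
Proof.
move=> fu gv hw.
have coord (p : T -> 'rV[R]_3) (q : 'rV[R]_3) : p @ F --> q ->
    forall j, p x 0 j @[x --> F] --> q 0 j.
  move=> pq j; exact: (cvg_comp _ _ pq (@coord_continuous R _ _ 0 j q)).
have {}fu := coord _ _ fu.
have {}gv := coord _ _ gv.
have {}hw := coord _ _ hw.
rewrite bracket3E; under eq_fun do rewrite bracket3E.
have minor i j : g x 0 i * h x 0 j - g x 0 j * h x 0 i @[x --> F] -->
    v 0 i * w 0 j - v 0 j * w 0 i.
  by apply: cvgB; apply: cvgM; [exact: gv|exact: hw|exact: gv|exact: hw].
apply: cvgD; first by apply: cvgB; apply: cvgM; by [exact: fu|exact: minor].
by apply: cvgM; [exact: fu|exact: minor].
Qed.

Lemma normr_bracket3 u v w : `|bracket3 u v w| <= 6 * (`|u| * `|v| * `|w|).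
Proof.
have coord_le (y : 'rV[R]_3) j : `|y 0 j| <= `|y|.
  by rewrite /Num.norm/= mx_normrE; apply: (le_trans _ (le_bigmax _ _ (0, j))).
have monomial_le (i j k : 'I_3) : `|u 0 i * v 0 j * w 0 k| <= `|u| * `|v| * `|w|.
  by rewrite !normrM !ler_pM// mulr_ge0.
rewrite bracket3E.
have := (monomial_le (o 0) (o 1) (o 2), monomial_le (o 0) (o 2) (o 1),
  monomial_le (o 1) (o 0) (o 2), (monomial_le (o 1) (o 2) (o 0),
  monomial_le (o 2) (o 0) (o 1), monomial_le (o 2) (o 1) (o 0))).
rewrite !ler_norml => -[[[]]] /andP[? ?] /andP[? ?] /andP[? ?] [[]].
move=> /andP[? ?] /andP[? ?] /andP[? ?].
by apply/andP; split; lra.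
Qed.
End Bracket.

(** * Derivatives relative to a segment *)

Section DerivativeOn.
Context (R : realType) (V : normedModType R).
Implicit Types (I : set R) (f : R -> V) (t : R) (l : V).

Definition is_derive_on I f t l :=
  difference_quotient f t @ within I t^' --> l.

Lemma smooth_on_is_derive_on I f n t : smooth_on I f -> I t ->
  is_derive_on I (derive_onn I n f) t (derive_onn I n.+1 f t).
Proof. by move=> sf It; exact: sf. Qed.

Lemma is_derive_on_cvg_dnbhs I f t l :
  is_derive_on I f t l -> f @ within I t^' --> f t.
Proof.
move=> dfl.
have st0 : (s - t) @[s --> within I t^'] --> (0 : R).
  rewrite -(subrr t); apply: cvgB; last exact: cvg_cst.
  by apply: cvg_within_filter; exact: nbhs_dnbhs.
have lin : (f t + (s - t) *: difference_quotient f t s) @[s --> within I t^'] --> f t.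
  rewrite -[X in _ --> X]addr0 -(scale0r l).
  by apply: cvgD; [exact: cvg_cst|exact: cvgZ].
apply: cvg_trans lin; apply: near_eq_cvg.
apply: cvg_within; near=> s.
rewrite /difference_quotient scalerA divff ?scale1r; first by rewrite addrC subrK.
by rewrite subr_eq0; near: s; exact: nbhs_dnbhs_neq.
Unshelve. all: by end_near. Qed.

Lemma is_derive_on_cvg I f t l :
  is_derive_on I f t l -> f @ within I (nbhs t) --> f t.
Proof.
move=> /is_derive_on_cvg_dnbhs /cvgrPdist_le ft.
apply/cvgrPdist_le => e e0; move: (ft e e0).
rewrite /prop_near1 /= /nbhs /= /within /dnbhs /within /=.
apply: (@filterS _ (nbhs t)) => s H Is.
by have [->|/H/(_ Is)//] := eqVneq s t; rewrite subrr normr0 ltW.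
Qed.

End DerivativeOn.

Section DerivativeOnSegment.
Context (R : realType) (T : R).
Context (T_gt0 : 0 < T).
Local Notation I := (`[0, T]%classic : set R).

(** Limits through points of [[0, T]] are unique because the segment has no
    isolated point; the witness moves right from [t], or left when [t] is the
    right endpoint. *)
Lemma within_dnbhs_proper t : I t -> ProperFilter (within I t^').
Proof.
rewrite /= in_itv/= => /andP[t0 tT].
split; last exact: within_filter.
rewrite /dnbhs /within/= => /nbhs_ballP[e /= e0 eF].
have {}e0 : 0 < e := e0.
have [tT'|tT'] := ltP t T.
- have d0 : 0 < Num.min (e / 2) (T - t) by rewrite lt_min divr_gt0//= subr_gt0.
  set d := Num.min _ _ in d0.
  have [de dT] : d <= e / 2 /\ d <= T - t by rewrite !ge_min !lexx orbT.
  clearbody d.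
  apply: (eF (t + d)).
  + have -> : ball t e (t + d) = (`|t - (t + d)| < e) by [].
    by rewrite ltr_norml; apply/andP; split; lra.
  + by rewrite gt_eqF// ltrDl.
  + by rewrite in_itv/=; apply/andP; split; lra.
- have d0 : 0 < Num.min (e / 2) t by rewrite lt_min divr_gt0//= (lt_le_trans T_gt0).
  set d := Num.min _ _ in d0.
  have [de dT] : d <= e / 2 /\ d <= t by rewrite !ge_min !lexx orbT.
  clearbody d.
  apply: (eF (t - d)).
  + have -> : ball t e (t - d) = (`|t - (t - d)| < e) by [].
    by rewrite ltr_norml; apply/andP; split; lra.
  + by rewrite lt_eqF// ltrBlDr ltrDl.
  + by rewrite in_itv/=; apply/andP; split; lra.
Qed.

Lemma is_derive_on_unique (V : normedModType R) (f : R -> V) t l :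
  I t -> is_derive_on I f t l -> derive_on I f t = l.
Proof.
move=> It; have := within_dnbhs_proper It => PF.
by rewrite /is_derive_on /derive_on; exact: cvg_lim.
Qed.

Lemma is_derive_on_continuous (V : normedModType R) (f df : R -> V) :
  (forall t, I t -> is_derive_on I f t (df t)) -> {within I, continuous f}.
Proof.
by move=> dff; apply/subspace_continuousP => t It; exact: is_derive_on_cvg (dff t It).
Qed.

Lemma is_derive_on_interior (f : R -> R) t (l : R) : t \in `]0, T[ ->
  is_derive_on I (f : R -> R^o) t l -> is_derive t 1 (f : R -> R^o) l.
Proof.
rewrite in_itv/= => /andP[t0 tT] dfl.
have dfl' : h^-1 *: ((f \o shift t) (h *: 1) - f t) @[h --> 0^'] --> (l : R^o).
  have sh : (h *: 1 + t) @[h --> (0:R)^'] `=>` within I t^'.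
    move=> A IA; have {IA} /nbhs_ballP[e /= e0 eA] :
      nbhs t [set x | x != t -> I x -> A x] by exact: IA.
    near=> h.
    have h0 : h != 0 by near: h; exact: nbhs_dnbhs_neq.
    have hT : `|h| < Num.min t (T - t).
      by near: h; apply: dnbhs0_lt; rewrite lt_min t0 subr_gt0.
    have he : `|h| < e by near: h; exact: dnbhs0_lt.
    change (A (h * 1 + t)); rewrite mulr1; apply: eA.
    + by rewrite /ball/= opprD addrC subrK normrN.
    + by rewrite -subr_eq0 addrK.
    + by rewrite in_itv/=; move: hT; rewrite lt_min !ltr_norml; lra.
  have := cvg_comp _ _ sh dfl; apply: cvg_trans; apply: near_eq_cvg.
  by near=> h; rewrite /= /difference_quotient [h *: 1]mulr1 addrK.
by apply: DeriveDef; [apply/cvg_ex; exists l|exact: cvg_lim].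
Unshelve. all: by end_near. Qed.

(** Inside the segment the relative derivative is the usual one, and continuity
    up to the endpoints is all that the mean value theorem asks there. *)
Lemma mvt_on (f df : R -> R) :
  (forall t, I t -> is_derive_on I (f : R -> R^o) t (df t : R^o)) ->
  forall s t, I s -> I t ->
  exists2 r, I r /\ `|r - t| <= `|s - t| & f s - f t = df r * (s - t).
Proof.
move=> dff.
have cf := is_derive_on_continuous dff.
have ordered s t : I s -> I t -> s < t ->
    exists2 r, s < r < t & f t - f s = df r * (t - s).
  rewrite /= !in_itv/= => /andP[s0 sT] /andP[t0 tT] st.
  have [||r rst ->] := @MVT R f df s t st.
  - move=> x; rewrite in_itv/= => /andP[sx xt].
    apply: is_derive_on_interior; first by rewrite in_itv/=; lra.
    by apply: dff; rewrite /= in_itv/=; lra.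
  - apply: continuous_subspaceW cf => x /=; rewrite !in_itv/=; lra.
  - by move: rst; rewrite in_itv/= => rst; exists r.
move=> s t Is It; have [st|ts|->] := ltgtP s t.
- have [r /andP[sr rt] E] := ordered _ _ Is It st.
  exists r; last by rewrite -[LHS]opprB E -mulrN opprB.
  split; first by move: Is It; rewrite /= !in_itv/=; lra.
  by rewrite !ltr0_norm ?subr_lt0//; lra.
- have [r /andP[sr rt] E] := ordered _ _ It Is ts.
  exists r => //.
  split; first by move: Is It; rewrite /= !in_itv/=; lra.
  by rewrite !gtr0_norm ?subr_gt0//; lra.
- by exists t; rewrite ?subrr ?mulr0.
Qed.

Lemma is_derive_on_eq_in (V : normedModType R) (f g : R -> V) t l :
  I t -> {in I, f =1 g} -> is_derive_on I f t l -> is_derive_on I g t l.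
Proof.
move=> It fg; apply: cvg_trans; apply: fmap_within_eq => s Is.
by rewrite /difference_quotient fg// fg// inE.
Qed.

Lemma bounded_on (V : normedModType R) (f : R -> V) :
  {within I, continuous f} -> exists M : R, forall t, I t -> `|f t| <= M.
Proof.
move=> cf.
have /compact_bounded/pinfty_ex_gt0[M M0 HM] :=
  continuous_compact cf (@segment_compact _ 0 T).
by exists M => t It; apply: HM; exists t.
Qed.

End DerivativeOnSegment.

Section Calculus.
Context (R : realType).
Implicit Types (I : set R) (t : R).

Lemma is_derive_onB (V : normedModType R) I (f g : R -> V) t l m :
  is_derive_on I f t l -> is_derive_on I g t m ->
  is_derive_on I (fun s => f s - g s) t (l - m).
Proof.
move=> fl gm; rewrite /is_derive_on.
rewrite (_ : difference_quotient _ t =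
  fun s => difference_quotient f t s - difference_quotient g t s); last first.
  by apply/funext => s; rewrite /difference_quotient -scalerBr !opprD !opprK addrACA.
exact: cvgB.
Qed.

Lemma is_derive_is_derive_on I (f : R -> R) t (l : R) :
  is_derive t 1 (f : R -> R^o) l -> is_derive_on I (f : R -> R^o) t l.
Proof.
case=> /cvg_ex[m dfm] dfl.
have {dfl} ml : m = l by rewrite -dfl; apply/esym; exact: cvg_lim.
rewrite {}ml in dfm.
have sh : (s - t) @[s --> within I t^'] `=>` (0:R)^'.
  move=> A /nbhs_ballP[e /= e0 eA]; apply: cvg_within.
  apply/nbhs_ballP; exists e => //= s ts st; apply: eA.
    by rewrite /ball/= sub0r normrN distrC.
  by rewrite subr_eq0.
have := cvg_comp _ _ sh dfm; apply: cvg_trans; apply: near_eq_cvg.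
by near=> s; rewrite /= /difference_quotient [(s - t) *: 1]mulr1 subrK.
Unshelve. all: by end_near. Qed.

(** Leibniz rule, telescoping the difference of brackets one slot at a time. *)
Lemma is_derive_on_bracket3 I (u v w : R -> 'rV[R]_3) t du dv dw :
  is_derive_on I u t du -> is_derive_on I v t dv -> is_derive_on I w t dw ->
  is_derive_on I (fun s => bracket3 (u s) (v s) (w s) : R^o) t
    (bracket3 du (v t) (w t) + bracket3 (u t) dv (w t) + bracket3 (u t) (v t) dw).
Proof.
move=> ud vd wd; rewrite /is_derive_on.
rewrite (_ : difference_quotient _ t = fun s =>
    bracket3 (difference_quotient u t s) (v s) (w s)
    + bracket3 (u t) (difference_quotient v t s) (w s)
    + bracket3 (u t) (v t) (difference_quotient w t s)); last first.
  apply/funext => s; rewrite /difference_quotient.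
  by rewrite /GRing.scale/= !bracket3E !mxE; ring.
have vt := is_derive_on_cvg_dnbhs vd.
have wt := is_derive_on_cvg_dnbhs wd.
by apply: cvgD; first apply: cvgD; apply: cvg_bracket3 => //; exact: cvg_cst.
Qed.

Lemma is_derive_on_cst (V : normedModType R) I (v : V) t :
  is_derive_on I (fun=> v) t 0.
Proof.
rewrite /is_derive_on (_ : difference_quotient _ t = fun=> 0); first exact: cvg_cst.
by apply/funext => s; rewrite /difference_quotient subrr scaler0.
Qed.

End Calculus.

(** * Taylor expansion relative to a segment *)

Section Taylor.
Context (R : realType) (T : R).
Local Notation I := (`[0, T]%classic : set R).

Let taylor_poly (F : nat -> R -> R) (t : R) n : {poly R} :=
  \sum_(k < n) (F k t / k`!%:R) *: ('X - t%:P) ^+ k.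

Let taylor_polyE F t n s :
  (taylor_poly F t n).[s] = \sum_(k < n) F k t / k`!%:R * (s - t) ^+ k.
Proof.
by rewrite horner_sum; apply: eq_bigr => k _; rewrite !hornerE.
Qed.

Let deriv_taylor_poly F t n :
  (taylor_poly F t n.+1)^`() = taylor_poly (fun k => F k.+1) t n.
Proof.
rewrite raddf_sum /= big_ord_recl /= expr0 derivZ derivC scaler0 add0r.
apply: eq_bigr => k _; rewrite derivZ deriv_exp derivB derivX derivC subr0.
rewrite /= /bump /= add1n /= mul1r -scalerMnr scalerMnl; congr (_ *: _).
by rewrite -mulr_natr factS natrM; field; rewrite nat1r !pnatr_eq0 -lt0n fact_gt0.
Qed.

(** Induction on the order: the derivative of the remainder is the remainder of
    order one less for the derivative. The mean value theorem is used crudely,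
    without integrating, so the factorial is missing from the bound. *)
Lemma taylor_on (F : nat -> R -> R) n (M : R) :
  (forall k t, I t -> is_derive_on I (F k : R -> R^o) t (F k.+1 t : R^o)) ->
  (forall s, I s -> `|F n s| <= M) ->
  forall s t, I s -> I t ->
  `|F 0 s - \sum_(k < n) F k t / k`!%:R * (s - t) ^+ k| <= M * `|s - t| ^+ n.
Proof.
move=> dF FM s t Is It; rewrite -taylor_polyE.
elim: n F dF FM s Is => [|n IH] F dF FM s Is.
  by rewrite /taylor_poly big_ord0 horner0 subr0 expr0 mulr1 FM.
have dG r : I r -> is_derive_on I
    (fun s => F 0 s - (taylor_poly F t n.+1).[s] : R^o) r
    (F 1 r - (taylor_poly (fun k => F k.+1) t n).[r]).
  move=> Ir; apply: is_derive_onB; first exact: dF.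
  apply: is_derive_is_derive_on; rewrite -deriv_taylor_poly derivE derive1E.
  by apply: derivableP; exact: derivable_horner.
have [r [Ir rt]] := mvt_on dG Is It.
have -> : F 0 t - (taylor_poly F t n.+1).[t] = 0.
  rewrite taylor_polyE big_ord_recl /= big1 ?fact0 ?expr0; first by field.
  by move=> i _; rewrite subrr expr0n /= mulr0.
rewrite subr0 => ->; rewrite normrM exprSr mulrA ler_wpM2r//.
apply: le_trans (IH (fun k => F k.+1) _ _ r Ir) _ => //.
  by move=> k; exact: dF.
rewrite ler_wpM2l ?lerXn2r ?nnegrE//.
exact: le_trans (FM _ It).
Qed.

End Taylor.

(** * Real cube roots *)

Section CubeRoot.
Context (R : realType).
Implicit Types x y e h : R.

Lemma cbrtK x : cbrt x ^+ 3 = x.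
Proof.
have cube y : 0 <= y -> (y `^ 3^-1) ^+ 3 = y.
  by move=> y0; rewrite -powR_mulrn ?powR_ge0// -powRrM mulVf ?powRr1.
by rewrite /cbrt exprMn cube//; case: sgrP => [->|x0|x0]; ring.
Qed.

(** The cube root is Hoelder of exponent 1/3, because
    4 (x^2 + x y + y^2) = (x - y)^2 + 3 (x + y)^2. *)
Lemma normB_cube_le x y : `|x - y| ^+ 3 <= 4 * `|x ^+ 3 - y ^+ 3|.
Proof.
rewrite (_ : x ^+ 3 - y ^+ 3 = (x - y) * (x ^+ 2 + x * y + y ^+ 2)); last by ring.
rewrite normrM mulrCA [leLHS]exprS ler_wpM2l// real_normK ?num_real//.
rewrite ger0_norm; last first.
  rewrite (_ : x ^+ 2 + x * y + y ^+ 2 =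
    2^-1 * ((x + y) ^+ 2 + x ^+ 2 + y ^+ 2)); last by field.
  by rewrite mulr_ge0 ?invr_ge0// !addr_ge0 ?sqr_ge0.
have -> : 4 * (x ^+ 2 + x * y + y ^+ 2) = (x - y) ^+ 2 + 3 * (x + y) ^+ 2.
  by ring.
by rewrite lerDl mulr_ge0 ?sqr_ge0.
Qed.

Lemma dist_le_of_cubes x y e :
  0 <= e -> 4 * `|x ^+ 3 - y ^+ 3| <= e ^+ 3 -> `|x - y| <= e.
Proof.
move=> e0 xye; rewrite -(@ler_pXn2r _ 3) ?nnegrE//.
exact: le_trans (normB_cube_le _ _) _.
Qed.

Lemma cbrt_close x y e :
  0 <= e -> 4 * `|x - y| <= e ^+ 3 -> `|cbrt x - cbrt y| <= e.
Proof. by move=> e0 xye; apply: dist_le_of_cubes => //; rewrite !cbrtK. Qed.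

Lemma cbrtM_cube h x : cbrt (h ^+ 3 * x) = h * cbrt x.
Proof.
apply/eqP; rewrite -subr_eq0 -normr_le0; apply: dist_le_of_cubes => //.
by rewrite cbrtK [(h * _) ^+ 3]exprMn cbrtK subrr normr0 mulr0 expr0n.
Qed.

Lemma continuous_cbrt : continuous (@cbrt R).
Proof.
move=> x; apply/cvgrPdist_le => e e0; near=> y.
apply: cbrt_close; first exact: ltW.
rewrite -ler_pdivlMl//; near: y; apply: cvgr_dist_le; first exact: cvg_id.
by rewrite mulr_gt0 ?invr_gt0 ?exprn_gt0.
Unshelve. all: by end_near. Qed.

End CubeRoot.

(** * Riemann sums *)

Section RiemannSum.
Context (R : realType) (T : R) (G : R -> R).
Context (T_gt0 : 0 < T).
Local Notation I := (`[0, T]%classic : set R).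
Context (G_continuous : {within I, continuous (G : R -> R^o)}).
Local Notation mu := (@lebesgue_measure R).

Let integrable_on (A : set R) :
  measurable A -> A `<=` I -> mu.-integrable A (EFin \o G).
Proof.
move=> mA AI; have iI : mu.-integrable I (EFin \o G).
  by apply: continuous_compact_integrable => //; exact: segment_compact.
by apply: integrableS iI => //.
Qed.

Let J x := \int[mu]_(t in `[0, x]) G t.

Let dist_integral_le (c e x y : R) : 0 <= x -> x <= y -> y <= T ->
  (forall s, x <= s <= y -> `|G s - c| <= e) ->
  `|J y - J x - (y - x) * c| <= (y - x) * e.
Proof.
move=> x0 xy yT Gce.
have iy : mu.-integrable `[0, y] (EFin \o G).
  by apply: integrable_on => // s /=; rewrite !in_itv/=; lra.
rewrite /J Rintegral_itvB//.
have ixy : mu.-integrable `]x, y] (EFin \o G).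
  by apply: integrable_on => // s /=; rewrite !in_itv/=; lra.
have len : fine (mu `]x, y]) = y - x.
  rewrite lebesgue_measure_itv/= lte_fin; case: ltP => //= yx.
  by have -> : x = y by [lra]; rewrite subrr.
have icst r : mu.-integrable `]x, y] (EFin \o cst r).
  apply: measurable_bounded_integrable => //.
  - by rewrite /= lebesgue_measure_itv/=; case: ifP => _; rewrite -?EFinB ltry.
  - by exists `|r|; split => // s rs t _ /=; exact: ltW.
have lo : (c - e) * (y - x) <= \int[mu]_(t in `]x, y]) G t.
  rewrite -len -Rintegral_cst//; apply: le_Rintegral; rewrite //; first exact: icst.
  move=> s /=.
  rewrite in_itv/= => /andP[xs sy]; have := Gce s.
  by rewrite (ltW xs) sy ler_norml => /(_ isT); lra.
have hi : \int[mu]_(t in `]x, y]) G t <= (c + e) * (y - x).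
  rewrite -len -Rintegral_cst//; apply: le_Rintegral; rewrite //; first exact: icst.
  move=> s /=.
  rewrite in_itv/= => /andP[xs sy]; have := Gce s.
  by rewrite (ltW xs) sy ler_norml => /(_ isT); lra.
move: lo hi; move: (\int[mu]_(t in `]x, y]) G t) => Z; clear => ? ?.
by rewrite ler_norml; apply/andP; split; lra.
Qed.

(** A sum agrees with the integral up to o(1) as soon as each term agrees with
    h G, up to o(h), throughout its cell of length h. The m + k cells left out
    at the two ends contribute O(h). *)
Lemma riemann_sum_cvg (X : nat -> nat -> R) (m k : nat) :
  (forall e, 0 < e -> \forall N \near \oo, forall j, (m <= j < N - k)%N ->
    forall s, j%:R * (T / N%:R) <= s <= j.+1%:R * (T / N%:R) ->
    `|X N j - T / N%:R * G s| <= e * (T / N%:R)) ->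
  \sum_(m <= j < N - k) X N j @[N --> \oo] --> \int[mu]_(t in I) G t.
Proof.
move=> XG.
have [M GM] := bounded_on G_continuous.
have M0 : 0 <= M.
  by apply: le_trans (GM 0 _) => //=; rewrite in_itv/= lexx ltW.
apply/cvgrPdist_le => e e0.
have e1 : 0 < e / (2 * T) by rewrite divr_gt0// mulr_gt0.
near=> N.
have N0 : (0 < N)%N by near: N; exact: nbhs_infty_gt.
have mkN : (m + k <= N)%N by near: N; exact: nbhs_infty_ge.
have XN : forall j, (m <= j < N - k)%N ->
    forall s, j%:R * (T / N%:R) <= s <= j.+1%:R * (T / N%:R) ->
    `|X N j - T / N%:R * G s| <= e / (2 * T) * (T / N%:R).
  by near: N; exact: XG.
have NM : (m + k)%:R * M * T * 2 / e <= N%:R by near: N; exact: nbhs_infty_ger.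
have NR0 : 0 < N%:R :> R by rewrite ltr0n.
set h := T / N%:R in XN *.
have h0 : 0 < h by rewrite divr_gt0.
have Nh : N%:R * h = T by rewrite /h mulrC divfK// gt_eqF.
have jh j : (j <= N)%N -> j%:R * h <= T by move=> jN; rewrite -Nh ler_pM2r// ler_nat.
have J0 : J 0 = 0 by rewrite /J set_itv1 Rintegral_set1.
have GM0 s : I s -> `|G s - 0| <= M by rewrite subr0; exact: GM.
have left_end : `|J (m%:R * h)| <= m%:R * h * M.
  have := @dist_integral_le 0 M 0 (m%:R * h); rewrite J0 !subr0 mulr0 subr0.
  apply => //; first by rewrite mulr_ge0// ltW.
    by apply: jh; lia.
  move=> s /andP[s0 sm]; apply: GM0; rewrite /= in_itv/= s0 (le_trans sm)//.
  by apply: jh; lia.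
have right_end : `|J T - J ((N - k)%:R * h)| <= k%:R * h * M.
  have := @dist_integral_le 0 M ((N - k)%:R * h) T; rewrite mulr0 subr0.
  rewrite (_ : T - (N - k)%:R * h = k%:R * h); last first.
    by rewrite -[in LHS]Nh natrB; [ring|lia].
  apply => //; first by rewrite mulr_ge0// ltW.
    by apply: jh; lia.
  move=> s /andP[s0 sm]; apply: GM0; rewrite /= in_itv/= sm andbT.
  by apply: le_trans s0; rewrite mulr_ge0// ltW.
have middle : `|\sum_(m <= j < N - k) X N j - (J ((N - k)%:R * h) - J (m%:R * h))|
    <= (N - k - m)%:R * (h * (e / (2 * T))).
  rewrite -(telescope_sumr (fun j => J (j%:R * h))); last by lia.
  rewrite -sumrB; apply: le_trans (ler_norm_sum _ _ _) _.
  rewrite (_ : (N - k - m)%:R * (h * (e / (2 * T))) =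
    \sum_(m <= j < N - k) h * (e / (2 * T))); last first.
    by rewrite sumr_const_nat mulr_natl.
  rewrite big_nat_cond [leRHS]big_nat_cond.
  apply: ler_sum => j; rewrite andbT => mjN; rewrite distrC.
  have := @dist_integral_le (X N j / h) (e / (2 * T)) (j%:R * h) (j.+1%:R * h).
  rewrite (_ : j.+1%:R * h - j%:R * h = h); last by rewrite -natr1; ring.
  rewrite [h * (X N j / h)]mulrC divfK ?gt_eqF//; apply.
  - by rewrite mulr_ge0// ltW.
  - by rewrite ler_pM2r// ler_nat.
  - by apply: jh; lia.
  - move=> s js.
    have -> : G s - X N j / h = - (X N j - h * G s) / h by field; rewrite gt_eqF.
    rewrite normrM normrN [X in _ * X]gtr0_norm ?invr_gt0// ler_pdivrMr//.
    exact: XN.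
have middle_le : (N - k - m)%:R * (h * (e / (2 * T))) <= e / 2.
  apply: (@le_trans _ _ (N%:R * (h * (e / (2 * T))))).
    by apply: ler_wpM2r; [rewrite ltW// mulr_gt0|rewrite ler_nat; lia].
  by rewrite mulrA Nh le_eqVlt; apply/orP; left; apply/eqP; field; rewrite gt_eqF.
have ends_le : m%:R * h * M + k%:R * h * M <= e / 2.
  rewrite -!mulrDl -natrD /h.
  move: NM; rewrite ler_pdivrMr// => NM.
  have -> : (m + k)%:R * (T / N%:R) * M = (m + k)%:R * M * T / N%:R by ring.
  by rewrite ler_pdivrMr//; move: NM; clear; lra.
rewrite -/(J T).
have -> : J T - \sum_(m <= j < N - k) X N j = (J T - J ((N - k)%:R * h)) + J (m%:R * h)
    - (\sum_(m <= j < N - k) X N j - (J ((N - k)%:R * h) - J (m%:R * h))) by ring.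
apply: le_trans (ler_normB _ _) _.
apply: le_trans (lerD (ler_normD _ _) (lexx _)) _.
by move: left_end right_end middle middle_le ends_le; clear; lra.
Unshelve. all: by end_near. Qed.
End RiemannSum.

(** * Coefficients of the recurrence, as functions of the step *)

Section LocalArithmetic.
Context (R : realType).
Implicit Types x y a b M q s A B eta rho tau beta : R.

Lemma ler_normD_le x y a b : `|x| <= a -> `|y| <= b -> `|x + y| <= a + b.
Proof. by move=> xa yb; apply: le_trans (ler_normD _ _) _; exact: lerD. Qed.

Lemma ler_normM_le x y a b : `|x| <= a -> `|y| <= b -> `|x * y| <= a * b.
Proof. by move=> xa yb; rewrite normrM ler_pM. Qed.

(** Big-O remainders become genuine factors, so that the estimates below are
    exact polynomial identities followed by a bound on one bounded factor. *)
Lemma remainder_factor x y M n : x != 0 -> `|y| <= M * `|x| ^+ n ->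
  exists2 q, `|q| <= M & y = x ^+ n * q.
Proof.
move=> x0 yM; exists (y / x ^+ n); last by rewrite mulrC divfK// expf_neq0.
by rewrite normrM normfV normrX ler_pdivrMr// exprn_gt0// normr_gt0.
Qed.

(** [jet1] and [jet0] are the Taylor expansions, at step [x], of the coordinates
    of phi(t + x) along phi'(t) and phi(t); [q] and [s] are normalized
    remainders. *)
Definition jet1 rho beta x q := x - x ^+ 3 / 6 * rho + x ^+ 4 / 24 * beta + x ^+ 5 * q.
Definition jet0 tau x s := 1 + x ^+ 3 / 6 * tau + x ^+ 4 * s.
(** The expansion of the coefficient A up to fourth order. *)
Definition coeff rho beta x := 3 - x ^+ 2 * rho + x ^+ 3 / 2 * beta.

(** Bounds a polynomial whose variables are bounded by hypotheses. The bound may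
    be an existential variable: it is then built from the bounds of the
    variables alone, hence is uniform. *)
Ltac bound_polynomial :=
  repeat (apply: ler_normD_le || apply: ler_normM_le || eassumption || exact: lexx).

Lemma jet1_lower_bound M eta rho beta q :
  0 <= M -> `|eta| <= 1 -> 4 * M * `|eta| <= 1 ->
  `|rho| <= M -> `|beta| <= M -> `|q| <= M ->
  `|eta| / 2 <= `|jet1 rho beta eta q|.
Proof.
move=> M0 eta1 Meta rhoM betaM qM.
pose r := - 6^-1 * (eta * rho) + 24^-1 * (eta * eta * beta)
  + eta * eta * eta * q.
have rM : `|r| <= 2 * M.
  have H : `|r| <= `|- 6^-1| * (1 * M) + `|24^-1| * (1 * 1 * M) + 1 * 1 * 1 * M.
    by rewrite /r; bound_polynomial.
  apply: le_trans H _; rewrite normrN !gtr0_norm ?invr_gt0//.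
  by move: M0; clear; lra.
have -> : jet1 rho beta eta q = eta * (1 + eta * r).
  by rewrite /jet1 /r; field.
rewrite normrM ler_wpM2l// -[leRHS]opprK lerNr.
have {}rM : `|eta * r| <= 2^-1.
  rewrite normrM; apply: le_trans (ler_wpM2l (normr_ge0 _) rM) _.
  by move: Meta; clear; lra.
have := ler_normB (1 + eta * r) (eta * r).
by rewrite addrK normr1; move: rM; clear; lra.
Qed.

(** The equation determines A as a quotient. Its denominator is of exact order
    eta, and multiplying the claimed value of A by it cancels the numerator
    through order eta^4. *)
Lemma first_coefficient_expansion M : 0 <= M ->
  exists C : R, forall eta rho beta A q1 qm q2,
  eta != 0 -> `|eta| <= 1 -> 4 * M * `|eta| <= 1 ->
  `|rho| <= M -> `|beta| <= M -> `|q1| <= M -> `|qm| <= M -> `|q2| <= M ->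
  jet1 rho beta (2 * eta) q2 - jet1 rho beta (- eta) qm =
    A * jet1 rho beta eta q1 ->
  `|A - coeff rho beta eta| <= C * eta ^+ 4.
Proof.
move=> M0.
(* Q is the leftover of that cancellation divided by eta^5. *)
pose Q eta rho beta q1 qm q2 := 32 * q2 + qm +
  - 1 * ((3 + - 1 * (eta * eta * rho) + eta * eta * eta * 2^-1 * beta) * q1)
  + - 6^-1 * (rho * rho) + 8^-1 * (eta * rho * beta)
  + - 48^-1 * (eta * eta * beta * beta).
have [C QC] : exists C : R, forall eta rho beta q1 qm q2,
    `|eta| <= 1 -> `|rho| <= M -> `|beta| <= M ->
    `|q1| <= M -> `|qm| <= M -> `|q2| <= M -> `|Q eta rho beta q1 qm q2| <= C.
  by eexists => eta rho beta q1 qm q2 *; rewrite /Q; bound_polynomial.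
exists (2 * C) => eta rho beta A q1 qm q2 eta0 eta1 Meta rhoM betaM q1M qmM q2M E.
have low := jet1_lower_bound M0 eta1 Meta rhoM betaM q1M.
have {}QC := QC _ _ _ _ _ _ eta1 rhoM betaM q1M qmM q2M.
have {}E : (A - coeff rho beta eta) * jet1 rho beta eta q1 =
    eta ^+ 5 * Q eta rho beta q1 qm q2.
  by rewrite mulrBl -E /jet1 /coeff /Q; field.
have eta_gt0 : 0 < `|eta| by rewrite normr_gt0.
have : `|A - coeff rho beta eta| * (`|eta| / 2) <= `|eta| ^+ 5 * C.
  apply: le_trans (ler_wpM2l (normr_ge0 _) low) _.
  by rewrite -normrM E normrM normrX ler_wpM2l// exprn_ge0.
rewrite mulrCA exprS -mulrA ler_pM2l// -normrX.
rewrite [`|eta ^+ 4|]ger0_norm; last exact: exprn_even_ge0.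
by clear; lra.
Qed.

(** Once A is known, the coordinate along phi(t) gives A + B: the constant terms
    of the left side cancel, and 3/2 - 3/6 = 1 is the coefficient of tau. *)
Lemma coefficient_sum_expansion M : 0 <= M ->
  exists C : R, forall eta rho tau beta A B s1 sm s2,
  `|eta| <= 1 -> `|rho| <= M -> `|tau| <= M -> `|beta| <= M ->
  `|s1| <= M -> `|sm| <= M -> `|s2| <= M ->
  `|A - coeff rho beta eta| <= M * eta ^+ 4 ->
  jet0 tau (2 * eta) s2 - jet0 tau (- eta) sm = A * jet0 tau eta s1 + B ->
  `|A + B - eta ^+ 3 * tau| <= C * eta ^+ 4.
Proof.
move=> M0.
(* S is the error divided by eta^4, where A = coeff + eta^4 e. *)
pose S eta rho tau beta e s1 sm s2 := 16 * s2 + - 1 * sm +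
  - 6^-1 * (- 1 * (eta * rho) + eta * eta * 2^-1 * beta + eta * eta * eta * e) * tau
  + - 1 * (3 + - 1 * (eta * eta * rho) + eta * eta * eta * 2^-1 * beta
           + eta * eta * eta * eta * e) * s1.
have [C SC] : exists C : R, forall eta rho tau beta e s1 sm s2,
    `|eta| <= 1 -> `|rho| <= M -> `|tau| <= M -> `|beta| <= M -> `|e| <= M ->
    `|s1| <= M -> `|sm| <= M -> `|s2| <= M ->
    `|S eta rho tau beta e s1 sm s2| <= C.
  by eexists => eta rho tau beta e s1 sm s2 *; rewrite /S; bound_polynomial.
exists C => eta rho tau beta A B s1 sm s2 eta1 rhoM tauM betaM s1M smM s2M AM E.
have eta4 : eta ^+ 4 = `|eta| ^+ 4.
  by rewrite -normrX ger0_norm// exprn_even_ge0.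
have [eta0|eta0] := eqVneq eta 0.
  move: E AM; rewrite eta0 /jet0 /coeff => E AM.
  rewrite !expr0n /= mul0r subr0 mulr0.
  suff -> : A + B = 0 by rewrite normr0.
  by move: E; rewrite mulr0 oppr0 !expr0n /= !mul0r; lra.
have [e eM Ae] : exists2 e, `|e| <= M & A - coeff rho beta eta = eta ^+ 4 * e.
  by apply: remainder_factor; rewrite -?eta4.
have -> : A + B - eta ^+ 3 * tau = eta ^+ 4 * S eta rho tau beta e s1 sm s2.
  have -> : B = jet0 tau (2 * eta) s2 - jet0 tau (- eta) sm - A * jet0 tau eta s1.
    by rewrite E; ring.
  have -> : A = coeff rho beta eta + eta ^+ 4 * e by rewrite -Ae; ring.
  by rewrite /jet0 /coeff /S; field.
rewrite normrM normrX -eta4 mulrC ler_wpM2r ?SC// eta4 exprn_ge0//.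
Qed.

End LocalArithmetic.

(** * Discrete invariants from a linear recurrence *)

Section PlaneRelation.
Context (R : realType).
Implicit Types (u v w x e : 'rV[R]_3).

Lemma plane_relation v w e x : bracket3 v w e != 0 -> bracket3 v w x = 0 ->
  exists A B : R, x = A *: w + B *: v.
Proof.
move=> vwe vwx; have := bracket3_cramer v w e x.
rewrite vwx scale0r addr0 => E.
exists (bracket3 v x e / bracket3 v w e), (bracket3 x w e / bracket3 v w e).
apply: (@scalerI _ _ (bracket3 v w e)) => //; rewrite E scalerDr !scalerA.
by rewrite addrC; congr (_ *: _ + _ *: _); field.
Qed.

Lemma plane_coordinates v w e (x y z t : R) : bracket3 v w e != 0 ->
  x *: w + y *: v = z *: w + t *: v -> x = z /\ y = t.
Proof.
move=> vwe E.
have E1 := congr1 (fun p => bracket3 p w e) E.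
have E2 := congr1 (fun p => bracket3 v p e) E.
split; apply: (mulIf vwe).
  transitivity (bracket3 v (x *: w + y *: v) e).
    by rewrite !bracket3E !mxE; ring.
  by rewrite E !bracket3E !mxE; ring.
transitivity (bracket3 (x *: w + y *: v) w e).
  by rewrite !bracket3E !mxE; ring.
by rewrite E !bracket3E !mxE; ring.
Qed.

(** The discrete invariants are the coefficients of the recurrence in disguise;
    the vector [e] only witnesses that two consecutive vertices are independent,
    which makes the invariants unique. *)
Lemma disc_invariants_recurrence (p : nat -> 'rV[R]_3) i e A B :
  (0 < i)%N -> bracket3 (p i) (p i.+1) e != 0 ->
  p i.+2 - p i.-1 = A *: p i.+1 + B *: p i ->
  disc_invariants p i = (3 - A, B + 3, A + B).
Proof.
move=> i_gt0 ie pAB.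
have D3 : diff3 p i = (A - 3) *: p i.+1 + (B + 3) *: p i.
  apply/rowP => j; have := congr1 (fun q : 'rV[R]_3 => q 0 j) pAB.
  by rewrite /diff3 /diff2 /diff1 /= prednK// !mxE; lra.
apply: get_unique => /=.
  by split; rewrite D3; apply/rowP => j; rewrite /diff1 !mxE; ring.
case=> -[x y] z /= [E1 E2].
have {}E1 : (A - 3) *: p i.+1 + (B + 3) *: p i = (z - y) *: p i.+1 + y *: p i.
  by rewrite -D3 E1; apply/rowP => j; rewrite /diff1 !mxE; ring.
have {}E2 : (A - 3) *: p i.+1 + (B + 3) *: p i = (- x) *: p i.+1 + (x + z) *: p i.
  by rewrite -D3 E2; apply/rowP => j; rewrite /diff1 !mxE; ring.
have [zy yB] := plane_coordinates ie E1.
have [xA _] := plane_coordinates ie E2.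
by congr (_, _, _); lra.
Qed.

End PlaneRelation.

(** * The moving frame of a unimodular curve *)

Section Frame.
Context (R : realType) (T : R) (D : nat -> R -> 'rV[R]_3).
Local Notation I := (`[0, T]%classic : set R).
Context (T_gt0 : 0 < T).
Context (dD : forall n t, I t -> is_derive_on I (D n) t (D n.+1 t)).
Context (D_unimodular : forall t, I t -> bracket3 (D 0 t) (D 1 t) (D 2 t) = 1).

(** The coordinates of the third derivative are [frame_tau] along the curve and
    the opposite of [frame_rho] along its tangent; [frame_beta] is the tangent
    coordinate of the fourth derivative. *)
Definition frame_tau t := bracket3 (D 3 t) (D 1 t) (D 2 t).
Definition frame_rho t := bracket3 (D 0 t) (D 2 t) (D 3 t).
Definition frame_beta t := bracket3 (D 0 t) (D 4 t) (D 2 t).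

(** The derivative of the constant bracket [phi, phi', phi'']. *)
Lemma bracket3_D013 t : I t -> bracket3 (D 0 t) (D 1 t) (D 3 t) = 0.
Proof.
move=> It; have dc := is_derive_on_bracket3 (@dD 0 _ It) (@dD 1 _ It) (@dD 2 _ It).
have d0 : is_derive_on I
    (fun s => bracket3 (D 0 s) (D 1 s) (D 2 s) : R^o) t (0 : R^o).
  apply: is_derive_on_eq_in (is_derive_on_cst I (1 : R^o) t) => //.
  by move=> s; rewrite inE => /D_unimodular ->.
have := is_derive_on_unique T_gt0 It dc.
rewrite (is_derive_on_unique T_gt0 It d0) => E.
move: E; clear.
move: (D 0 t) (D 1 t) (D 2 t) (D 3 t) => u v w x E.
by rewrite [RHS]E !bracket3E; ring.
Qed.

Lemma frenet_equation t : I t ->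
  D 3 t = - frame_rho t *: D 1 t + frame_tau t *: D 0 t.
Proof.
move=> It; have := bracket3_cramer (D 0 t) (D 1 t) (D 2 t) (D 3 t).
rewrite D_unimodular// bracket3_D013// scale1r scale0r addr0 => E.
rewrite {1}E addrC /frame_tau /frame_rho; congr (_ *: _ + _).
by move: (D 0 t) (D 2 t) (D 3 t) => u w x; rewrite !bracket3E; ring.
Qed.

Lemma frenet_unique t r u : I t -> D 3 t = - r *: D 1 t + u *: D 0 t ->
  r = frame_rho t /\ u = frame_tau t.
Proof.
move=> It; rewrite frenet_equation// => E.
have ne0 : bracket3 (D 0 t) (D 1 t) (D 2 t) != 0 by rewrite D_unimodular// oner_eq0.
by have [/oppr_inj -> ->] := plane_coordinates ne0 E.
Qed.

(** Differentiating [phi, phi'', phi'''] gives [phi', phi'', phi'''], which is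
    tau by rotation, and [phi, phi'', phi'''']. *)
Lemma is_derive_on_frame_rho t : I t ->
  is_derive_on I (frame_rho : R -> R^o) t (frame_tau t - frame_beta t).
Proof.
move=> It; have := is_derive_on_bracket3 (@dD 0 _ It) (@dD 2 _ It) (@dD 3 _ It).
rewrite (_ : _ + _ + _ = frame_tau t - frame_beta t) //.
by rewrite /frame_tau /frame_beta !bracket3E; ring.
Qed.

Lemma derivatives_bounded n : exists2 K : R, 0 <= K &
  forall m t, (m <= n)%N -> I t -> `|D m t| <= K.
Proof.
have bd m : exists K : R, forall t, I t -> `|D m t| <= K.
  by apply: bounded_on; apply: is_derive_on_continuous => t; exact: dD.
elim: n => [|n [K K0 HK]].
  have [K HK] := bd 0%N; exists `|K| => // m t; rewrite leqn0 => /eqP -> It.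
  exact: le_trans (HK _ It) (ler_norm _).
have [L HL] := bd n.+1; exists (K + `|L|); first exact: addr_ge0.
move=> m t; rewrite leq_eqVlt => /predU1P[->|mn] It.
  by apply: le_trans (HL _ It) (le_trans (ler_norm _) _); rewrite lerDr.
by apply: le_trans (HK _ _ mn It) _; rewrite lerDl.
Qed.

Lemma bracket_derivatives_bounded n : exists2 M : R, 0 <= M &
  forall i j k s t r, (i <= n)%N -> (j <= n)%N -> (k <= n)%N ->
  I s -> I t -> I r -> `|bracket3 (D i s) (D j t) (D k r)| <= M.
Proof.
have [K K0 HK] := derivatives_bounded n.
exists (6 * (K * K * K)); first by rewrite !mulr_ge0.
move=> i j k s t r i_n j_n k_n Is It Ir; apply: le_trans (normr_bracket3 _ _ _) _.
by rewrite ler_wpM2l// !ler_pM ?mulr_ge0 ?HK.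
Qed.

Lemma bracket_derivatives_lipschitz i j k : exists L : R, forall s t, I s -> I t ->
  `|bracket3 (D i s) (D j s) (D k s) - bracket3 (D i t) (D j t) (D k t)|
    <= L * `|s - t|.
Proof.
have [M _ HM] := bracket_derivatives_bounded (maxn i (maxn j k)).+1.
exists (3 * M) => s t Is It.
have [r [Ir _] ->] := @mvt_on R T _ (fun r => bracket3 (D i.+1 r) (D j r) (D k r)
  + bracket3 (D i r) (D j.+1 r) (D k r) + bracket3 (D i r) (D j r) (D k.+1 r))
  (fun r Ir => is_derive_on_bracket3 (@dD i _ Ir) (@dD j _ Ir) (@dD k _ Ir)) _ _ Is It.
rewrite normrM ler_wpM2r//.
have deriv_le a b c : (a <= (maxn i (maxn j k)).+1)%N -> (b <= (maxn i (maxn j k)).+1)%N ->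
    (c <= (maxn i (maxn j k)).+1)%N ->
    `|bracket3 (D a r) (D b r) (D c r)| <= M by move=> *; exact: HM.
have -> : 3 * M = M + M + M by ring.
by apply: ler_normD_le; first apply: ler_normD_le; apply: deriv_le; lia.
Qed.

(** This is rho' + 2 tau, with rho' rewritten as tau - beta. *)
Definition density t := 3 * frame_tau t - frame_beta t.

Lemma density_lipschitz : exists2 L : R, 0 <= L & forall s t, I s -> I t ->
  `|density s - density t| <= L * `|s - t|.
Proof.
have [L1 H1] := bracket_derivatives_lipschitz 3 1 2.
have [L2 H2] := bracket_derivatives_lipschitz 0 4 2.
exists (3 * `|L1| + `|L2|); first by rewrite addr_ge0// mulr_ge0.
move=> s t Is It.
have -> : density s - density t =
  3 * (frame_tau s - frame_tau t) + - 1 * (frame_beta s - frame_beta t).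
  by rewrite /density; ring.
rewrite [leRHS]mulrDl; apply: ler_normD_le.
  rewrite normrM (ger0_norm (ler0n _ 3)) -mulrA ler_wpM2l//.
  by apply: le_trans (H1 _ _ Is It) _; rewrite ler_wpM2r// ler_norm.
rewrite mulN1r normrN.
by apply: le_trans (H2 _ _ Is It) _; rewrite ler_wpM2r// ler_norm.
Qed.

(** Pairing the recurrence with phi'' and either phi or phi' leaves two scalar
    equations, whose data are Taylor expanded about the one parameter [t]. The
    step [x] is of either sign: negative steps are what the recurrence based at
    the previous vertex needs. *)
Lemma local_expansion : exists C h0 : R, [/\ 0 <= C, 0 < h0 &
  forall t x, I t -> I (t + x) -> I (t - x) -> I (t + 2 * x) ->
  x != 0 -> `|x| <= h0 ->
  bracket3 (D 0 t) (D 0 (t + x)) (D 2 t) != 0 /\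
  forall A B : R, D 0 (t + 2 * x) - D 0 (t - x) = A *: D 0 (t + x) + B *: D 0 t ->
  `|A - coeff (frame_rho t) (frame_beta t) x| <= C * x ^+ 4 /\
  `|A + B - x ^+ 3 * frame_tau t| <= C * x ^+ 4].
Proof.
have [M M0 HM] := bracket_derivatives_bounded 5.
have [C1 HC1] := first_coefficient_expansion M0.
have M'0 : 0 <= M + `|C1| by rewrite addr_ge0.
have [C2 HC2] := coefficient_sum_expansion M'0.
(* The step must make the tangent coordinate of phi (t + x) nonzero. *)
exists (`|C1| + `|C2|), (Num.min 1 (4 * M + 1)^-1).
have M41 : 0 < 4 * M + 1 by rewrite ltr_wpDl// mulr_ge0.
split; [exact: addr_ge0|by rewrite lt_min ltr01 invr_gt0|].
move=> t x It Itx Itmx It2x x0; rewrite le_min => /andP[x1 xM].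
have {xM} Mx : 4 * M * `|x| <= 1.
  move: xM; rewrite -[X in _ <= X]div1r ler_pdivlMr// => xM.
  apply: le_trans xM; rewrite [leRHS]mulrC ler_wpM2r//.
  by rewrite lerDl.
have rhoM : `|frame_rho t| <= M by exact: HM.
have tauM : `|frame_tau t| <= M by exact: HM.
have betaM : `|frame_beta t| <= M by exact: HM.
have jet1P (y : R) : y != 0 -> I (t + y) -> exists2 q, `|q| <= M &
    bracket3 (D 0 t) (D 0 (t + y)) (D 2 t) = jet1 (frame_rho t) (frame_beta t) y q.
  move=> y0 Ity.
  have dF k s : I s -> is_derive_on I
      (fun s => bracket3 (D 0 t) (D k s) (D 2 t) : R^o) s
      (bracket3 (D 0 t) (D k.+1 s) (D 2 t)).
    move=> Is; have := is_derive_on_bracket3 (is_derive_on_cst I (D 0 t) s)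
      (@dD k _ Is) (is_derive_on_cst I (D 2 t) s).
    by congr is_derive_on; rewrite !bracket3E !mxE; ring.
  have := taylor_on (n := 5) dF (fun s Is => HM 0 5 2 t s t isT isT isT It Is It) Ity It.
  rewrite [t + y]addrC addrK => /(remainder_factor y0)[q qM E].
  exists q => //; rewrite /jet1 -E !big_ord_recl big_ord0 /= !factS fact0 /bump /=.
  have -> : bracket3 (D 0 t) (D 0 t) (D 2 t) = 0 by rewrite !bracket3E; ring.
  have -> : bracket3 (D 0 t) (D 2 t) (D 2 t) = 0 by rewrite !bracket3E; ring.
  have -> : bracket3 (D 0 t) (D 3 t) (D 2 t) = - frame_rho t.
    by rewrite /frame_rho !bracket3E; ring.
  rewrite D_unimodular// -/(frame_beta t) !natrM.
  by field.
have jet0P (y : R) : y != 0 -> I (t + y) -> exists2 s, `|s| <= M &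
    bracket3 (D 0 (t + y)) (D 1 t) (D 2 t) = jet0 (frame_tau t) y s.
  move=> y0 Ity.
  have dF k s : I s -> is_derive_on I
      (fun s => bracket3 (D k s) (D 1 t) (D 2 t) : R^o) s
      (bracket3 (D k.+1 s) (D 1 t) (D 2 t)).
    move=> Is; have := is_derive_on_bracket3 (@dD k _ Is)
      (is_derive_on_cst I (D 1 t) s) (is_derive_on_cst I (D 2 t) s).
    by congr is_derive_on; rewrite !bracket3E !mxE; ring.
  have := taylor_on (n := 4) dF (fun s Is => HM 4 1 2 s t t isT isT isT Is It It) Ity It.
  rewrite [t + y]addrC addrK => /(remainder_factor y0)[q qM E].
  exists q => //; rewrite /jet0 -E !big_ord_recl big_ord0 /= !factS fact0 /bump /=.
  have -> : bracket3 (D 1 t) (D 1 t) (D 2 t) = 0 by rewrite !bracket3E; ring.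
  have -> : bracket3 (D 2 t) (D 1 t) (D 2 t) = 0 by rewrite !bracket3E; ring.
  rewrite D_unimodular// -/(frame_tau t) !natrM.
  by field.
have x2 : 2 * x != 0 by rewrite mulf_neq0.
have nx0 : - x != 0 by rewrite oppr_eq0.
have [q1 q1M E1] := jet1P x x0 Itx.
have [qm qmM Em] := jet1P (- x) nx0 Itmx.
have [q2 q2M E2] := jet1P (2 * x) x2 It2x.
have [s1 s1M F1] := jet0P x x0 Itx.
have [sm smM Fm] := jet0P (- x) nx0 Itmx.
have [s2 s2M F2] := jet0P (2 * x) x2 It2x.
have x4 : 0 <= x ^+ 4 by exact: exprn_even_ge0.
split.
  rewrite -normr_gt0 E1.
  apply: lt_le_trans (jet1_lower_bound M0 x1 Mx rhoM betaM q1M).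
  by rewrite divr_gt0// normr_gt0.
move=> A B AB.
have AC : `|A - coeff (frame_rho t) (frame_beta t) x| <= C1 * x ^+ 4.
  apply: HC1 x0 x1 Mx rhoM betaM q1M qmM q2M _.
  rewrite -E1 -Em -E2.
  transitivity (bracket3 (D 0 t) (D 0 (t + 2 * x) - D 0 (t - x)) (D 2 t)).
    by rewrite !bracket3E !mxE; ring.
  by rewrite AB !bracket3E !mxE; ring.
have MM' (y : R) : `|y| <= M -> `|y| <= M + `|C1|.
  by move=> yM; apply: le_trans yM _; rewrite lerDl.
split.
  apply: le_trans AC _; rewrite ler_wpM2r//.
  by apply: le_trans (ler_norm _) _; rewrite lerDl.
apply: (@le_trans _ _ (C2 * x ^+ 4)); last first.
  by rewrite ler_wpM2r//; apply: le_trans (ler_norm _) _; rewrite lerDr.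
have := HC2 x _ _ _ A B _ _ _ x1 (MM' _ rhoM) (MM' _ tauM) (MM' _ betaM)
  (MM' _ s1M) (MM' _ smM) (MM' _ s2M).
apply.
  apply: le_trans AC _; rewrite ler_wpM2r//.
  by apply: le_trans (ler_norm _) _; rewrite lerDr.
rewrite -F1 -Fm -F2.
transitivity (bracket3 (D 0 (t + 2 * x) - D 0 (t - x)) (D 1 t) (D 2 t)).
  by rewrite !bracket3E !mxE; ring.
rewrite AB; have := D_unimodular It; rewrite !bracket3E !mxE => one.
by rewrite -[B in RHS]mulr1 -[in RHS]one; ring.
Qed.

End Frame.

(** * The summands of the discrete lengths *)

Section SampledPolygon.
Context (R : realType) (T : R) (phi : R -> 'rV[R]_3).
Local Notation I := (`[0, T]%classic : set R).
Context (T_gt0 : 0 < T).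
Context (phi_smooth : smooth_on I phi).
Let D n := derive_onn I n phi.
Context (phi_unimodular : forall t, I t -> bracket3 (D 0 t) (D 1 t) (D 2 t) = 1).

Let dD n t : I t -> is_derive_on I (D n) t (D n.+1 t).
Proof. exact: smooth_on_is_derive_on. Qed.

Lemma smooth_invariantsE t : I t ->
  smooth_invariants T phi t = (frame_rho D t, frame_tau D t).
Proof.
move=> It; apply: get_unique; first exact: (frenet_equation T_gt0 dD phi_unimodular It).
by case=> r u /= /(frenet_unique T_gt0 dD phi_unimodular It)[-> ->].
Qed.

Lemma pl_integrand t : I t ->
  derive_on I (smooth_rho T phi : R -> R^o) t + 2 * smooth_tau T phi t = density D t.
Proof.
move=> It; rewrite (_ : derive_on _ _ _ = frame_tau D t - frame_beta D t); last first.
  apply: is_derive_on_unique => //.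
  apply: is_derive_on_eq_in (is_derive_on_frame_rho dD It) => // s; rewrite inE => Is.
  by rewrite /smooth_rho smooth_invariantsE.
by rewrite /smooth_tau smooth_invariantsE//= /density; ring.
Qed.

(** Both summands combine the recurrences based at the edges on either side of
    the vertex [j]. Expanding both about that vertex, the backward one with
    step - h, makes the odd terms in beta add up instead of producing a
    difference quotient of rho. The half-integer shift explains why the second
    summand is taken at [j.-1]. *)
Lemma summand_expansion : exists C h0 : R, [/\ 0 <= C, 0 < h0 &
  forall N j, (3 <= j < N.-1)%N -> T / N%:R <= h0 ->
  equal_volume N (sample T phi N) ->
  let h := T / N%:R in let p := sample T phi N in
  `|diff1 (disc_rho1 p) j + 2 * disc_tau p j - h ^+ 3 * density D (j%:R * h)|
    <= C * h ^+ 4 /\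
  `|diff1 (disc_rho2 p) j.-1 + 2 * disc_tau p j.-1
    - h ^+ 3 * density D (j%:R * h)| <= C * h ^+ 4].
Proof.
have [C [h0 [C0 h0_gt0 loc]]] := local_expansion dD phi_unimodular.
exists (5 * C), h0; split=> //; first exact: mulr_ge0.
(* With j = n.+2, the five vertices involved are p n, ..., p n.+4. *)
move=> N [|[|n]]// /andP[n_gt0 nN] hh0 [v pv].
move=> h p; rewrite -/h in hh0; rewrite -/p in pv.
have N0 : 0 < N%:R :> R by rewrite ltr0n; lia.
have h_gt0 : 0 < h by rewrite divr_gt0.
have Ih k : (k <= N)%N -> I (k%:R * h).
  move=> kN; rewrite /= in_itv/= mulr_ge0 ?(ltW h_gt0)//= /h mulrA ler_pdivrMr//.
  by rewrite mulrC ler_wpM2l ?ler_nat// ltW.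
set t := n.+2%:R * h.
have E0 : n%:R * h = t + 2 * - h by rewrite /t -[n.+2]addn2 natrD; ring.
have E1 : n.+1%:R * h = t - h by rewrite /t -[n.+2]addn1 natrD; ring.
have E3 : n.+3%:R * h = t + h by rewrite /t -[n.+3]addn1 natrD; ring.
have E4 : n.+4%:R * h = t + 2 * h by rewrite /t -[n.+4]addn2 natrD; ring.
have P0 : p n = D 0 (t + 2 * - h) by rewrite -E0.
have P1 : p n.+1 = D 0 (t - h) by rewrite -E1.
have P2 : p n.+2 = D 0 t by [].
have P3 : p n.+3 = D 0 (t + h) by rewrite -E3.
have P4 : p n.+4 = D 0 (t + 2 * h) by rewrite -E4.
have It : I t by apply: Ih; lia.
have I0 : I (t + 2 * - h) by rewrite -E0; apply: Ih; lia.
have I1 : I (t - h) by rewrite -E1; apply: Ih; lia.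
have I3 : I (t + h) by rewrite -E3; apply: Ih; lia.
have I4 : I (t + 2 * h) by rewrite -E4; apply: Ih; lia.
have V1 : bracket3 (p n) (p n.+1) (p n.+2) = v by apply: (pv n.+1); lia.
have V2 : bracket3 (p n.+1) (p n.+2) (p n.+3) = v by apply: (pv n.+2); lia.
have V3 : bracket3 (p n.+2) (p n.+3) (p n.+4) = v by apply: (pv n.+3); lia.
have hN0 : h != 0 by rewrite gt_eqF.
have nhN0 : - h != 0 by rewrite oppr_eq0.
have habs : `|h| <= h0 by rewrite gtr0_norm.
have nhabs : `|- h| <= h0 by rewrite normrN.
have [fwd0 fwd] := loc t h It I3 I1 I4 hN0 habs.
have I3' : I (t - - h) by rewrite opprK.
have [bwd0 bwd] := loc t (- h) It I1 I3' I0 nhN0 nhabs.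
rewrite -P2 -P3 -P1 -P4 in fwd fwd0.
rewrite opprK -P2 -P3 -P1 -P0 in bwd bwd0.
set e := D 2 t in fwd0 bwd0.
(* Equal volumes put the difference of the outer vertices in the plane of the
   inner two. *)
have {}bwd0 : bracket3 (p n.+1) (p n.+2) e != 0.
  by move: bwd0; rewrite -oppr_eq0; congr (_ != 0); rewrite !bracket3E; ring.
have [A [B AB]] : exists A B : R, p n.+4 - p n.+1 = A *: p n.+3 + B *: p n.+2.
  apply: (plane_relation fwd0).
  rewrite (_ : bracket3 _ _ _ = bracket3 (p n.+2) (p n.+3) (p n.+4)
    - bracket3 (p n.+1) (p n.+2) (p n.+3)); first by rewrite V3 V2 subrr.
  by rewrite !bracket3E !mxE; ring.
have [A' [B' AB']] : exists A B : R, p n.+3 - p n = A *: p n.+2 + B *: p n.+1.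
  apply: (plane_relation bwd0).
  rewrite (_ : bracket3 _ _ _ = bracket3 (p n.+1) (p n.+2) (p n.+3)
    - bracket3 (p n) (p n.+1) (p n.+2)); first by rewrite V2 V1 subrr.
  by rewrite !bracket3E !mxE; ring.
(* A and B belong to the forward recurrence, A' and B' to the backward one;
   reversing the latter exchanges its coefficients and their signs. *)
have inv2 := disc_invariants_recurrence (ltn0Sn n.+1) fwd0 AB.
have inv1 := disc_invariants_recurrence (ltn0Sn n) bwd0 AB'.
have [FA FB] := fwd A B AB.
have [|BA BB] := bwd (- B') (- A').
  by rewrite -opprB AB' opprD !scaleNr addrC.
rewrite /diff1 /disc_rho1 /disc_rho2 /disc_tau /= inv2 inv1 /=.
move: FA FB BA BB; rewrite /coeff /density.
rewrite (_ : (- h) ^+ 2 = h ^+ 2); last by ring.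
rewrite (_ : (- h) ^+ 3 = - h ^+ 3); last by ring.
rewrite (_ : (- h) ^+ 4 = h ^+ 4); last by ring.
move: (frame_rho D t) (frame_tau D t) (frame_beta D t) => r u b.
rewrite !ler_norml => /andP[? ?] /andP[? ?] /andP[? ?] /andP[? ?].
by split; apply/andP; split; lra.
Qed.

End SampledPolygon.

(** * Convergence of the lengths *)

Section Convergence.
Context (R : realType) (T : R) (phi : R -> 'rV[R]_3).
Local Notation I := (`[0, T]%classic : set R).
Context (T_gt0 : 0 < T).
Context (phi_smooth : smooth_on I phi).
Let D n := derive_onn I n phi.
Context (phi_unimodular : forall t, I t -> bracket3 (D 0 t) (D 1 t) (D 2 t) = 1).

Let dD n t : I t -> is_derive_on I (D n) t (D n.+1 t).
Proof. exact: smooth_on_is_derive_on. Qed.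

Lemma plE : pl T phi = \int[lebesgue_measure]_(t in I) cbrt (density D t).
Proof.
by apply: eq_Rintegral => t; rewrite inE => It; rewrite pl_integrand.
Qed.

Lemma cbrt_density_continuous :
  {within I, continuous ((fun t => cbrt (density D t)) : R -> R^o)}.
Proof.
apply/subspace_continuousP => t It.
have cD n := is_derive_on_cvg (@dD n _ It).
apply: (cvg_comp (density D) (@cbrt R)); last exact: continuous_cbrt.
apply: cvgB; last exact: cvg_bracket3.
by apply: cvgM; [exact: cvg_cst|exact: cvg_bracket3].
Qed.

Lemma mesh_small (r : R) : 0 < r -> \forall N \near \oo, T / N%:R <= r.
Proof.
move=> r0; near=> N; have N0 : 0 < N%:R :> R.
  by rewrite ltr0n; near: N; exact: nbhs_infty_gt.
rewrite ler_pdivrMr// mulrC -ler_pdivrMr//.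
near: N; exact: nbhs_infty_ger.
Unshelve. all: by end_near. Qed.

(** The cube root turns an error O(h^4) on h^3 density into an error
    O(h^(4/3)) = o(h) on h times the cube root of the density, so that the sum
    is a perturbed Riemann sum. *)
Lemma sum_cbrt_cvg (C : R) (S : nat -> nat -> R) :
  (\forall N \near \oo, forall j, (3 <= j < N.-1)%N ->
    `|S N j - (T / N%:R) ^+ 3 * density D (j%:R * (T / N%:R))|
      <= C * (T / N%:R) ^+ 4) ->
  \sum_(3 <= j < N.-1) cbrt (S N j) @[N --> \oo] --> pl T phi.
Proof.
move=> SC; rewrite plE; under eq_fun do rewrite -subn1.
have [L L0 HL] := density_lipschitz T_gt0 dD.
apply: (riemann_sum_cvg T_gt0 cbrt_density_continuous) => e e0.
have C1_gt0 : 0 < 4 * (`|C| + L) + 1 by rewrite ltr_wpDl// mulr_ge0// addr_ge0.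
have mesh : \forall N \near \oo, T / N%:R <= e ^+ 3 / (4 * (`|C| + L) + 1).
  by apply: mesh_small; rewrite divr_gt0 ?exprn_gt0.
near=> N => j jN s /andP[js sj].
have N0 : 0 < N%:R :> R by rewrite ltr0n; lia.
have SCN : forall j, (3 <= j < N.-1)%N ->
    `|S N j - (T / N%:R) ^+ 3 * density D (j%:R * (T / N%:R))|
      <= C * (T / N%:R) ^+ 4 by near: N; exact: SC.
rewrite subn1 in jN; have {SCN} := SCN j jN.
have he : T / N%:R <= e ^+ 3 / (4 * (`|C| + L) + 1).
  by near: N; exact: mesh.
have h0 : 0 < T / N%:R by rewrite divr_gt0.
have jT k : (k <= N)%N -> k%:R * (T / N%:R) <= T.
  by move=> kN; rewrite mulrA ler_pdivrMr// mulrC ler_wpM2l ?ler_nat// ltW.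
move: (T / N%:R) h0 he js sj jT => h h0 he js sj jT SCj.
have Ij : I (j%:R * h).
  by rewrite /= in_itv/= mulr_ge0 ?(ltW h0)//=; apply: jT; lia.
have Is : I s.
  rewrite /= in_itv/=; apply/andP; split.
    by apply: le_trans js; rewrite mulr_ge0 ?(ltW h0).
  by apply: le_trans sj _; apply: jT; lia.
have sjh : `|j%:R * h - s| <= h.
  rewrite distrC ger0_norm ?subr_ge0//; move: sj; rewrite -natr1 mulrDl mul1r.
  by lra.
have dens : `|density D (j%:R * h) - density D s| <= L * h.
  by apply: le_trans (HL _ _ Ij Is) _; rewrite ler_wpM2l.
move: SCj dens; move: (density D s) (density D (j%:R * h)) => ds dj SCj dens.
rewrite -cbrtM_cube; apply: cbrt_close; first by rewrite mulr_ge0 ?ltW.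
have h4 : 0 < h ^+ 4 by rewrite exprn_gt0.
have h3 : 0 < h ^+ 3 by rewrite exprn_gt0.
have le1 : `|S N j - h ^+ 3 * ds| <= (`|C| + L) * h ^+ 4.
  have -> : S N j - h ^+ 3 * ds = (S N j - h ^+ 3 * dj)
    + h ^+ 3 * (dj - ds) by ring.
  rewrite mulrDl; apply: ler_normD_le.
    by apply: le_trans SCj _; rewrite ler_wpM2r ?ler_norm// ltW.
  rewrite normrM gtr0_norm//; have -> : L * h ^+ 4 = h ^+ 3 * (L * h) by ring.
  by rewrite ler_pM2l.
have le2 : 4 * (`|C| + L) * h <= e ^+ 3.
  move: he; rewrite ler_pdivlMr// mulrC mulrDl mul1r; apply: le_trans.
  by rewrite lerDl ltW.
apply: le_trans (_ : 4 * ((`|C| + L) * h ^+ 4) <= _); first by rewrite ler_pM2l.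
have -> : 4 * ((`|C| + L) * h ^+ 4) = 4 * (`|C| + L) * h * h ^+ 3 by ring.
by rewrite exprMn ler_pM2r.
Unshelve. all: by end_near. Qed.

End Convergence.

Theorem corollary5p3 (R : realType) (T : R)
    (c : R -> 'rV[R]_2) (a : R -> R) (phi : R -> 'rV[R]_3)
    (T_gt0 : 0 < T)
    (c_smooth : smooth_on `[0, T]%classic c)
    (c_noinfl : without_inflection `[0, T]%classic c)
    (phi_lift : forall t, t \in `[0, T] -> phi t = lift_curve a c t)
    (phi_smooth : smooth_on `[0, T]%classic phi)
    (phi_unimodular : forall t, t \in `[0, T] ->
       bracket3 (phi t)
                (derive_onn `[0, T]%classic 1 phi t)
                (derive_onn `[0, T]%classic 2 phi t) = 1)
    (phi_equal_volume : \forall N \near \oo, equal_volume N (sample T phi N)) :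
  (pl1 N (sample T phi N) @[N --> \oo] --> pl T phi) /\
  (pl2 N (sample T phi N) @[N --> \oo] --> pl T phi).
Proof.
have [C [h0 [C0 h0_gt0 HC]]] := summand_expansion T_gt0 phi_smooth phi_unimodular.
pose p N := sample T phi N.
have {}HC : \forall N \near \oo, forall j, (3 <= j < N.-1)%N ->
    let h := T / N%:R in
    let g := h ^+ 3 * density (fun n => derive_onn `[0, T]%classic n phi) (j%:R * h) in
    `|diff1 (disc_rho1 (p N)) j + 2 * disc_tau (p N) j - g| <= C * h ^+ 4 /\
    `|diff1 (disc_rho2 (p N)) j.-1 + 2 * disc_tau (p N) j.-1 - g| <= C * h ^+ 4.
  near=> N => j jN; apply: HC => //; last by near: N.
  by near: N; exact: mesh_small.
have cvg_length S := sum_cbrt_cvg T_gt0 phi_smooth phi_unimodular (C := C) (S := S).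
split.
  apply: (cvg_length (fun N j => diff1 (disc_rho1 (p N)) j + 2 * disc_tau (p N) j)).
  by apply: filterS HC => N HN j /HN[].
have pl2E N : pl2 N (p N) = \sum_(3 <= j < N.-1)
    cbrt (diff1 (disc_rho2 (p N)) j.-1 + 2 * disc_tau (p N) j.-1).
  by rewrite big_add1.
under eq_fun do rewrite pl2E.
apply: (cvg_length
  (fun N j => diff1 (disc_rho2 (p N)) j.-1 + 2 * disc_tau (p N) j.-1)).
by apply: filterS HC => N HN j /HN[].
Unshelve. all: by end_near. Qed.
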